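(* Let $\mathfrak{C}\prec\mathfrak{C}'$ be models of a complete first-order theory $T$, both $\aleph_0$-saturated and strongly $\aleph_0$-homogeneous, and let $X$ be a $\emptyset$-type-definable subset of $\mathfrak{C}^\lambda$. Let $F'$ be a closed $\mathrm{Aut}(\mathfrak{C}')$-invariant equivalence relation on $S_X(\mathfrak{C}')$ and $F$ a closed $\mathrm{Aut}(\mathfrak{C})$-invariant equivalence relation on $S_X(\mathfrak{C})$. If $F'$ and $F$ are compatible, then the Ellis group of the flow $(\mathrm{Aut}(\mathfrak{C}'),S_X(\mathfrak{C}')/F')$ is topologically isomorphic to the Ellis group of the flow $(\mathrm{Aut}(\mathfrak{C}),S_X(\mathfrak{C})/F)$.
   Context: $S_X(\mathfrak{C})$ is the space of complete types over $\mathfrak{C}$ extending the partial type defining $X$, on which $\mathrm{Aut}(\mathfrak{C})$ (with the pointwise convergence topology) acts continuously; quotients by closed invariant equivalence relations are flows with the quotient topology. $F'$ and $F$ are compatible if $r[F']=F$, i.e. $\{(r(a),r(b)):(a,b)\in F'\}=F$, where $r:S_X(\mathfrak{C}')\to S_X(\mathfrak{C})$ is the restriction map. For a flow $(G,Y)$ (topological group acting continuously on a compact Hausdorff space), the Ellis semigroup $E(Y)$ is the closure in $Y^Y$ (product topology) of $\{y\mapsto gy: g\in G\}$, a compact left topological semigroup under composition. It has minimal left ideals; for a minimal left ideal $\mathcal{M}$ and an idempotent $u\in\mathcal{M}$, $u\mathcal{M}$ is a group, called the Ellis group (independent of choices up to isomorphism). The $\tau$-topology on $u\mathcal{M}$: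 for $a\in E(Y)$ and $B\subseteq E(Y)$, $a\circ B$ is the set of all limits of nets $(g_ib_i)$ with $g_i\in G$, $b_i\in B$, $\lim g_i=a$; the closed sets are given by the closure operator $\mathrm{cl}_\tau(B)=u\mathcal{M}\cap(u\circ B)$ for $B\subseteq u\mathcal{M}$. Topologically isomorphic means isomorphic as groups via a homeomorphism with respect to the $\tau$-topologies. *)

(* Defs.v *)
From HB Require Import structures.
From mathcomp Require Import all_boot all_order all_algebra.
From mathcomp Require Import all_classical topology.

Set Implicit Arguments.
Unset Strict Implicit.
Unset Printing Implicit Defensive.

Local Open Scope classical_set_scope.

Lemma filter_finite_bigcap (T I : Type) (s : set I) (f : I -> set T)
    (F : set_system T) : Filter F -> finite_set s ->
  (forall i, s i -> F (f i)) -> F (\bigcap_(i in s) f i).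
Proof.
move=> FF /(@finite_fsetP {classic I}) [K ->] H.
exact: (@filter_bigI T {classic I} K f).
Qed.

Lemma subbase_cvg (T : topologicalType) (D : set (set T)) (F : set_system T)
    (p : T) :
  Filter F ->
  (forall A, open A -> A p ->
    exists2 B, finI_from D id B & B p /\ B `<=` A) ->
  (forall A, D A -> A p -> F A) -> F --> p.
Proof.
move=> FF Dop DF A; rewrite /= nbhsE => -[U [oU Up] UA].
have [B [K KD KB] [Bp BU]] := Dop _ oU Up.
apply: (filterS UA); apply: (filterS BU); rewrite -KB.
apply: filter_bigI => V VK; apply: DF; first by have := KD _ VK; rewrite inE.
by move: Bp; rewrite -KB => /(_ _ VK).
Qed.

Record language := Language {
  fsym : Type; farity : fsym -> nat;
  rsym : Type; rarity : rsym -> nat }.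

Record structure (L : language) := Structure {
  dom :> Type;
  dom_inhabited : inhabited dom;
  finterp : forall f : fsym L, ('I_(farity f) -> dom) -> dom;
  rinterp : forall r : rsym L, ('I_(rarity r) -> dom) -> Prop }.

Inductive term (L : language) (V : Type) : Type :=
| Var of V
| App (f : fsym L) of ('I_(farity f) -> term L V).

(* [formula L V]: first-order formulas with free variables among [V]; the
   variable bound by [Forall] is [None]. The other connectives and the
   existential quantifier are taken as abbreviations. *)
Inductive formula (L : language) (V : Type) : Type :=
| Falsum
| Equal of term L V & term L V
| Rel (r : rsym L) of ('I_(rarity r) -> term L V)
| Imply of formula L V & formula L V
| Forall of formula L (option V).

Arguments Var {L V}.
Arguments App {L V}.
Arguments Falsum {L V}.
Arguments Equal {L V}.
Arguments Rel {L V}.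
Arguments Imply {L V}.
Arguments Forall {L V}.

Definition Neg L (V : Type) (phi : formula L V) : formula L V :=
  Imply phi Falsum.

Fixpoint trename L (V W : Type) (h : V -> W) (t : term L V) : term L W :=
  match t with
  | Var x => Var (h x)
  | App f u => App f (fun i => trename h (u i))
  end.

Fixpoint frename L (V W : Type) (h : V -> W) (phi : formula L V) {struct phi} :
    formula L W :=
  match phi with
  | Falsum => Falsum
  | Equal t u => Equal (trename h t) (trename h u)
  | Rel r u => Rel r (fun i => trename h (u i))
  | Imply phi psi => Imply (frename h phi) (frename h psi)
  | Forall phi => Forall (frename (omap h) phi)
  end.

Fixpoint teval L (M : structure L) (V : Type) (v : V -> M) (t : term L V) : M :=
  match t with
  | Var x => v x
  | App f u => finterp (fun i => teval v (u i))
  end.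

Fixpoint sat L (M : structure L) (V : Type) (v : V -> M) (phi : formula L V)
    {struct phi} : Prop :=
  match phi with
  | Falsum => False
  | Equal t u => teval v t = teval v u
  | Rel r u => rinterp (fun i => teval v (u i))
  | Imply phi psi => sat v phi -> sat v psi
  | Forall phi => forall x : M, sat (oapp v x) phi
  end.

Definition sentence L := formula L void.
Definition theory L := set (sentence L).

Definition models L (M : structure L) (T : theory L) : Prop :=
  forall s, T s -> sat (of_void M) s.

Definition entails L (T : theory L) (s : sentence L) : Prop :=
  forall M : structure L, models M T -> sat (of_void M) s.

Definition complete_theory L (T : theory L) : Prop :=
  (exists M : structure L, models M T) /\
  forall s, entails T s \/ entails T (Neg s).

(* [elementary_embedding j] is the relation $M \prec N$, the inclusion being
   an arbitrary injection [j] (injectivity is the case of [Equal]). *)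
Definition elementary_embedding L (M N : structure L) (j : M -> N) : Prop :=
  forall (V : Type) (v : V -> M) (phi : formula L V),
    sat v phi <-> sat (j \o v) phi.

Record aut L (M : structure L) := Aut {
  aut_fun :> M -> M;
  aut_inv : M -> M;
  aut_funK : cancel aut_fun aut_inv;
  aut_invK : cancel aut_inv aut_fun;
  aut_finterp : forall (f : fsym L) (u : 'I_(farity f) -> M),
    aut_fun (finterp u) = finterp (aut_fun \o u);
  aut_rinterp : forall (r : rsym L) (u : 'I_(rarity r) -> M),
    rinterp (aut_fun \o u) <-> rinterp u }.

Section types.
Context {L : language} (M : structure L) {I P : Type} (a : P -> M).

(* A formula with variables $(x_i)_{i \in I}$ and parameters named by [P] is
   an element of [formula L (I + P)]; [asg a x] assigns to them the tuple [x]
   and the parameters [a]. *)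
Definition asg (x : I -> M) (z : I + P) : M :=
  match z with inl i => x i | inr c => a c end.

Definition finitely_satisfiable (p : set (formula L (I + P))) : Prop :=
  forall s : set (formula L (I + P)), finite_set s -> s `<=` p ->
  exists x : I -> M, forall phi, s phi -> sat (asg x) phi.

Definition complete_type (p : set (formula L (I + P))) : Prop :=
  finitely_satisfiable p /\ forall phi, p phi \/ p (Neg phi).

Definition realizes (x : I -> M) (p : set (formula L (I + P))) : Prop :=
  forall phi, p phi -> sat (asg x) phi.

End types.

Definition aleph0_saturated L (M : structure L) : Prop :=
  forall (n k : nat) (a : 'I_n -> M) (p : set (formula L ('I_k + 'I_n))),
    complete_type a p -> exists x : 'I_k -> M, realizes a x p.

Definition strongly_aleph0_homogeneous L (M : structure L) : Prop :=
  forall (n : nat) (a b : 'I_n -> M),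
    (forall phi : formula L 'I_n, sat a phi <-> sat b phi) ->
  exists g : aut M, forall i, g (a i) = b i.

(* $X$ is the subset of $M^I$ defined by the partial type [pX] over the empty
   set. *)
Definition type_defined_by L (M : structure L) (I : Type) (X : set (I -> M))
    (pX : set (formula L I)) : Prop :=
  X = [set x | forall phi, pX phi -> sat x phi].

(* $S_X(M)$, where $X$ is defined by the partial type [pX]. *)
Record type_space L (M : structure L) (I : Type) (pX : set (formula L I)) :=
  TypeSpace {
    type_formulas : set (formula L (I + M));
    type_complete : complete_type (@id M) type_formulas;
    type_extends : forall phi, pX phi -> type_formulas (frename inl phi) }.

HB.mixin Record isTopologicalGroup G & Group G & Topological G := {
  mulg_continuous : continuous (fun gh : G * G => (gh.1 * gh.2)%g);
  invg_continuous : continuous (fun g : G => g^-1%g) }.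

#[short(type="topologicalGroupType")]
HB.structure Definition TopologicalGroup :=
  {G of Group G & Topological G & isTopologicalGroup G}.

Record flow := Flow {
  flow_group : topologicalGroupType;
  flow_space :> topologicalType;
  flow_act : flow_group -> flow_space -> flow_space;
  flow_act1 : forall y, flow_act 1%g y = y;
  flow_actM : forall g h y, flow_act (g * h)%g y = flow_act g (flow_act h y);
  flow_continuous :
    continuous (fun gy : flow_group * flow_space => flow_act gy.1 gy.2);
  flow_compact : compact [set: flow_space];
  flow_hausdorff : hausdorff_space flow_space }.

Record closed_invariant_equivalence (Y : flow) := ClosedInvariantEquivalence {
  eqv_rel : set (Y * Y);
  eqv_refl : forall x, eqv_rel (x, x);
  eqv_sym : forall x y, eqv_rel (x, y) -> eqv_rel (y, x);
  eqv_trans : forall x y z, eqv_rel (x, y) -> eqv_rel (y, z) -> eqv_rel (x, z);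
  eqv_closed : closed eqv_rel;
  eqv_invariant : forall (g : flow_group Y) x y,
    eqv_rel (x, y) -> eqv_rel (flow_act g x, flow_act g y) }.

Section quotient_flow.
Local Open Scope quotient_scope.
Variables (Y : flow) (F : closed_invariant_equivalence Y).

Definition eqv_bool (x y : Y) : bool := `[< eqv_rel F (x, y) >].

Lemma eqv_bool_refl : reflexive eqv_bool.
Proof. by move=> x; apply/asboolP; exact: eqv_refl. Qed.

Lemma eqv_bool_sym : symmetric eqv_bool.
Proof.
by move=> x y; apply/idP/idP => /asboolP ?; apply/asboolP; exact: eqv_sym.
Qed.

Lemma eqv_bool_trans : transitive eqv_bool.
Proof.
move=> y x z /asboolP xy /asboolP yz; apply/asboolP; exact: eqv_trans yz.
Qed.

Definition eqv_equiv : equiv_rel Y :=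
  EquivRel eqv_bool eqv_bool_refl eqv_bool_sym eqv_bool_trans.

Definition eqv_quotient : topologicalType :=
  quotient_topology {eq_quot eqv_equiv}.

Definition eqv_proj (y : Y) : eqv_quotient := \pi_({eq_quot eqv_equiv}) y.
Definition eqv_repr (q : eqv_quotient) : Y := repr (q : {eq_quot eqv_equiv}).

Lemma eqv_projE x y : eqv_proj x = eqv_proj y <-> eqv_rel F (x, y).
Proof.
split; first by move=> /eqmodP /asboolP.
by move=> ?; apply/eqmodP/asboolP.
Qed.

Lemma eqv_reprK : cancel eqv_repr eqv_proj.
Proof. by move=> q; exact: reprK. Qed.

Lemma eqv_proj_continuous : continuous eqv_proj.
Proof. exact: pi_continuous. Qed.

Lemma eqv_near (W : set Y) y : (forall z, eqv_rel F (y, z) -> nbhs z W) ->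
  \forall y' \near y, forall z, eqv_rel F (y', z) -> W z.
Proof.
move=> nW; have /compact_near_coveringP cY := @flow_compact Y.
have := @cY Y (nbhs y) (fun y' z => eqv_rel F (y', z) -> W z) _ _.
move=> /(_ _) H; apply: filterS (H _) => [y' + z|z _]; first exact.
have [Fyz|nF] := pselect (eqv_rel F (y, z)).
  exists (W, setT) => /=; first by split; [exact: nW|exact: filterT].
  by move=> -[a b] [/= ? _] _.
have : nbhs (y, z) (~` eqv_rel F).
  by apply: open_nbhs_nbhs; split=> //; exact/closed_openC/eqv_closed.
move=> -[[A B] /= [yA zB] AB]; exists (B, A) => //= -[a b] [/= Ba Ab] Fba.
by case: (AB (b, a)).
Qed.

Definition eqv_sat (W : set Y) : set eqv_quotient :=
  [set q | forall z, eqv_proj z = q -> W z].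

Lemma eqv_sat_open W : open W -> open (eqv_sat W).
Proof.
move=> oW; rewrite -[open _]/(open (eqv_proj @^-1` (eqv_sat W))) openE => y yW.
have : \forall y' \near y, forall z, eqv_rel F (y', z) -> W z.
  apply: eqv_near => z Fyz; apply: open_nbhs_nbhs; split=> //.
  by apply: yW; apply/esym/eqv_projE.
by apply: filterS => y' H z /esym /eqv_projE; exact: H.
Qed.

Lemma eqv_class_closed y : closed [set z | eqv_rel F (y, z)].
Proof.
rewrite -openC openE => z nF.
have : nbhs (y, z) (~` eqv_rel F).
  by apply: open_nbhs_nbhs; split=> //; exact/closed_openC/eqv_closed.
move=> -[[A B] /= [yA zB] AB]; apply: filterS zB => w Bw.
by apply: (AB (y, w)); split=> //; exact: nbhs_singleton.
Qed.

Lemma eqv_hausdorff : hausdorff_space eqv_quotient.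
Proof.
rewrite open_hausdorff => p q pq.
set x := eqv_repr p; set y := eqv_repr q.
have nF : ~ eqv_rel F (x, y).
  by move=> /eqv_projE; rewrite /x /y !eqv_reprK; exact/eqP.
have nY := compact_normal (@flow_hausdorff Y) (@flow_compact Y).
have [|V Vx VB] := nY _ (@eqv_class_closed x) (~` [set z | eqv_rel F (y, z)]).
  move=> z xz; apply: open_nbhs_nbhs; split.
    exact/closed_openC/eqv_class_closed.
  by move=> yz; apply: nF; apply: eqv_trans xz _; exact: eqv_sym.
exists (eqv_sat V°, eqv_sat (~` closure V)); rewrite /= ?inE; split.
- by move=> z; rewrite -[p]eqv_reprK => /esym /eqv_projE /Vx.
- by move=> z; rewrite -[q]eqv_reprK => /esym /eqv_projE yz /VB.
- exact/eqv_sat_open/open_interior.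
- exact/eqv_sat_open/closed_openC/closed_closure.
apply/seteqP; split=> // r [/(_ _ (eqv_reprK r)) + /(_ _ (eqv_reprK r))].
by move=> /interior_subset /subset_closure.
Qed.

Lemma eqv_compact : compact [set: eqv_quotient].
Proof.
have -> : [set: eqv_quotient] = eqv_proj @` [set: Y].
  by apply/seteqP; split=> // q _; exists (eqv_repr q) => //; exact: eqv_reprK.
apply: continuous_compact (@flow_compact Y).
exact/continuous_subspaceT/eqv_proj_continuous.
Qed.

Definition eqv_act (g : flow_group Y) (q : eqv_quotient) : eqv_quotient :=
  eqv_proj (flow_act g (eqv_repr q)).

Lemma eqv_act_proj g y : eqv_act g (eqv_proj y) = eqv_proj (flow_act g y).
Proof. by apply/eqv_projE/eqv_invariant/eqv_projE; rewrite eqv_reprK. Qed.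

Lemma eqv_act1 q : eqv_act 1%g q = q.
Proof. by rewrite /eqv_act flow_act1 eqv_reprK. Qed.

Lemma eqv_actM g h q : eqv_act (g * h)%g q = eqv_act g (eqv_act h q).
Proof. by rewrite {1}/eqv_act flow_actM -eqv_act_proj. Qed.

Lemma eqv_act_continuous :
  continuous (fun gq : flow_group Y * eqv_quotient => eqv_act gq.1 gq.2).
Proof.
move=> [g q] /= U; rewrite nbhsE => -[V [oV Vq] VU].
have /compact_near_coveringP cY := @flow_compact Y.
pose P (hr : flow_group Y * eqv_quotient) (z : Y) :=
  eqv_proj z = hr.2 -> V (eqv_proj (flow_act hr.1 z)).
suff : \forall hr \near (g, q), [set: Y] `<=` P hr.
  apply: filterS => -[h r] /= H; apply: VU.
  by apply: (H (eqv_repr r)) => //; exact: eqv_reprK.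
apply: (@cY _ (nbhs (g, q)) P _ _) => z _.
have [zq|zq] := eqVneq (eqv_proj z) q.
  have : nbhs (g, z) ((fun gz : flow_group Y * Y =>
      eqv_proj (flow_act gz.1 gz.2)) @^-1` V).
    apply: (@continuous_comp _ _ _
      (fun gz : flow_group Y * Y => flow_act gz.1 gz.2) eqv_proj).
    - exact: flow_continuous.
    - exact: eqv_proj_continuous.
    by apply: open_nbhs_nbhs; split=> //=; rewrite -eqv_act_proj zq.
  move=> -[[A B] /= [gA zB] AB].
  exists (B, A `*` setT) => /=; first split=> //.
    by exists (A, setT) => //=; split=> //; exact: filterT.
  by move=> -[z' [h r]] [/= Bz' [Ah _]] _; exact: (AB (h, z')).
have := eqv_hausdorff; rewrite open_hausdorff => /(_ _ _ zq)[[A B]].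
rewrite /= !inE => -[Az Bq] [oA oB AB0].
exists (eqv_proj @^-1` A, setT `*` B) => /=; first split=> //.
- by apply: eqv_proj_continuous; apply: open_nbhs_nbhs; split.
- exists (setT, B) => //=; split; first exact: filterT.
  exact: (open_nbhs_nbhs (conj oB Bq)).
move=> -[z' [h r]] [/= Az' [_ Br]] zr; exfalso.
have {}zr : eqv_proj z' = r := zr.
suff : (A `&` B) r by rewrite AB0.
by split=> //; rewrite -zr.
Qed.

Definition quotient_flow : flow :=
  Flow eqv_act1 eqv_actM eqv_act_continuous eqv_compact eqv_hausdorff.

End quotient_flow.

Section aut_group.
Context {L : language} {M : structure L}.
Implicit Types g h : aut M.

Lemma aut_ext g h : aut_fun g =1 aut_fun h -> g = h.
Proof.
case: g h => [f f' fK f'K ff fr] [e e' eK e'K ef er] /= /funext fe; subst e.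
have ? : f' = e' by apply/funext => x; rewrite -{1}[x]e'K fK.
by subst e'; congr Aut; exact: Prop_irrelevance.
Qed.

Definition aut_one : aut M := @Aut L M id id (fun=> erefl) (fun=> erefl)
  (fun _ _ => erefl) (fun _ _ => iff_refl _).

Lemma aut_inv_finterp g (f : fsym L) (u : 'I_(farity f) -> M) :
  aut_inv g (finterp u) = finterp (aut_inv g \o u).
Proof.
rewrite -[RHS](aut_funK g) aut_finterp.
suff -> : g \o (aut_inv g \o u) = u by [].
by apply/funext => i /=; rewrite aut_invK.
Qed.

Lemma aut_inv_rinterp g (r : rsym L) (u : 'I_(rarity r) -> M) :
  rinterp (aut_inv g \o u) <-> rinterp u.
Proof.
apply: iff_trans (iff_sym (aut_rinterp g (aut_inv g \o u))) _.
suff -> : g \o (aut_inv g \o u) = u by [].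
by apply/funext => i /=; rewrite aut_invK.
Qed.

Definition aut_opp g : aut M := @Aut L M (aut_inv g) g
  (aut_invK g) (aut_funK g) (@aut_inv_finterp g) (@aut_inv_rinterp g).

Lemma aut_comp_finterp g h (f : fsym L) (u : 'I_(farity f) -> M) :
  (g \o h) (finterp u) = finterp ((g \o h) \o u).
Proof. by rewrite /= !aut_finterp. Qed.

Lemma aut_comp_rinterp g h (r : rsym L) (u : 'I_(rarity r) -> M) :
  rinterp ((g \o h) \o u) <-> rinterp u.
Proof. exact: iff_trans (aut_rinterp g (h \o u)) (aut_rinterp h u). Qed.

Definition aut_mul g h : aut M :=
  @Aut L M (g \o h) (aut_inv h \o aut_inv g)
    (can_comp (aut_funK g) (aut_funK h)) (can_comp (aut_invK h) (aut_invK g))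
    (@aut_comp_finterp g h) (@aut_comp_rinterp g h).

HB.instance Definition _ := gen_eqMixin (aut M).
HB.instance Definition _ := gen_choiceMixin (aut M).

Lemma aut_mulA : associative aut_mul.
Proof. by move=> f g h; exact: aut_ext. Qed.
Lemma aut_mul1g : left_id aut_one aut_mul.
Proof. by move=> g; exact: aut_ext. Qed.
Lemma aut_mulg1 : right_id aut_one aut_mul.
Proof. by move=> g; exact: aut_ext. Qed.
Lemma aut_mulVg : left_inverse aut_one aut_opp aut_mul.
Proof. by move=> g; apply: aut_ext => x /=; rewrite aut_funK. Qed.
Lemma aut_mulgV : right_inverse aut_one aut_opp aut_mul.
Proof. by move=> g; apply: aut_ext => x /=; rewrite aut_invK. Qed.

HB.instance Definition _ := isGroup.Build (aut M)
  aut_mulA aut_mul1g aut_mulg1 aut_mulVg aut_mulgV.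

(* Pointwise convergence, [M] being discrete. *)
Definition aut_subbase : set (set (aut M)) :=
  [set U | exists a b : M, U = [set g | aut_fun g a = b]].

HB.instance Definition _ :=
  isSubBaseTopological.Build (aut M) aut_subbase id.

Lemma aut_cvg (F : set_system (aut M)) {FF : Filter F} g :
  (forall a, F [set h | aut_fun h a = aut_fun g a]) -> F --> g.
Proof.
move=> Fg; apply: (subbase_cvg (D := aut_subbase)).
  move=> A [D' D'sub <-] [B D'B Bg]; exists B; first exact: D'sub.
  by split=> // h Bh; exists B.
by move=> A [a [b ->]] /= <-.
Qed.

Lemma aut_nbhs g a : nbhs g [set h | aut_fun h a = aut_fun g a].
Proof.
apply: open_nbhs_nbhs; split=> //.
exists [set [set h : aut M | aut_fun h a = aut_fun g a]]; last first.
  by rewrite bigcup_set1.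
by move=> _ ->; apply: finI_from1; exists a, (g a).
Qed.

Lemma aut_mul_continuous :
  continuous (fun gh : aut M * aut M => (gh.1 * gh.2)%g).
Proof.
move=> [g h]; apply: aut_cvg => a.
exists ([set g' : aut M | g' (h a) = g (h a)], [set h' : aut M | h' a = h a]).
  by split; exact: aut_nbhs.
by move=> -[g' h'] [/= eg eh]; rewrite -eg -eh.
Qed.

Lemma aut_inv_continuous : continuous (fun g : aut M => g^-1%g).
Proof.
move=> g; apply: (@aut_cvg _ (fmap_filter _ (nbhs_filter g))) => a /=.
apply: filterS (aut_nbhs g (aut_inv g a)) => h /=.
rewrite aut_invK => e; change (aut_inv h a = aut_inv g a).
by apply: (can_inj (aut_funK h)); rewrite aut_invK e.
Qed.

HB.instance Definition _ :=
  isTopologicalGroup.Build (aut M) aut_mul_continuous aut_inv_continuous.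

End aut_group.

Section renaming.
Context {L : language}.

Lemma trename_id (V : Type) (t : term L V) : trename id t = t.
Proof. by elim: t => //= f u IH; congr App; apply/funext. Qed.

Lemma omap_idE (V : Type) : omap (@id V) = id.
Proof. by apply/funext => -[]. Qed.

Lemma frename_id (V : Type) (phi : formula L V) : frename id phi = phi.
Proof.
elim: phi => {V} //= [V t u|V r u|V p -> q ->//|V p].
- by rewrite !trename_id.
- by congr Rel; apply/funext => i; exact: trename_id.
- by rewrite omap_idE => ->.
Qed.

Lemma trename_comp (U V W : Type) (h : V -> W) (k : U -> V) (t : term L U) :
  trename h (trename k t) = trename (h \o k) t.
Proof. by elim: t => //= f u IH; congr App; apply/funext. Qed.

Lemma frename_comp (U V W : Type) (h : V -> W) (k : U -> V) (phi : formula L U) :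
  frename h (frename k phi) = frename (h \o k) phi.
Proof.
elim: phi V W h k => {U} //= [U t u|U r u|U p IHp q IHq|U p IH] V W h k.
- by rewrite !trename_comp.
- by congr Rel; apply/funext => i; exact: trename_comp.
- by rewrite IHp IHq.
- by rewrite IH; congr (Forall (frename _ _)); apply/funext => -[].
Qed.

Lemma teval_trename (M : structure L) (V W : Type) (h : V -> W) (v : W -> M) t :
  teval v (trename h t) = teval (v \o h) t.
Proof. by elim: t => //= f u IH; congr finterp; apply/funext. Qed.

Lemma sat_frename (M : structure L) (V W : Type) (h : V -> W) (v : W -> M) phi :
  sat v (frename h phi) <-> sat (v \o h) phi.
Proof.
elim: phi W h v => {V} //= [V t u|V r u|V p IHp q IHq|V p IH] W h v.
- by rewrite !teval_trename.
- by under eq_fun do rewrite teval_trename.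
- by split=> H /IHp /H /IHq.
- have E x : oapp v x \o omap h = oapp (v \o h) x by apply/funext => -[].
  split=> H x; first by rewrite -E; apply/IH; exact: H.
  by apply/IH; rewrite E; exact: H.
Qed.

Lemma sat_Neg (M : structure L) (V : Type) (v : V -> M) phi :
  sat v (Neg phi) <-> ~ sat v phi.
Proof. by []. Qed.

Lemma teval_aut (M : structure L) (g : aut M) (V : Type) (v : V -> M) t :
  teval (g \o v) t = g (teval v t).
Proof.
by elim: t => //= f u IH; rewrite aut_finterp; congr finterp; apply/funext.
Qed.

Lemma sat_aut (M : structure L) (g : aut M) (V : Type) (v : V -> M) phi :
  sat (g \o v) phi <-> sat v phi.
Proof.
elim: phi v => {V} //= [V t u|V r u|V p IHp q IHq|V p IH] v.
- by rewrite !teval_aut; split=> [/(can_inj (aut_funK g))|->].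
- by under eq_fun do rewrite teval_aut; exact: aut_rinterp.
- by split=> H /IHp /H /IHq.
- have E x : oapp (g \o v) (g x) = g \o oapp v x by apply/funext => -[].
  split=> H x; first by apply/IH; rewrite -E.
  by rewrite -[x](aut_invK g) E; apply/IH.
Qed.

Fixpoint tvars (V : Type) (t : term L V) : set V :=
  match t with
  | Var x => [set x]
  | App f u => \bigcup_i tvars (u i)
  end.

Fixpoint fvars (V : Type) (phi : formula L V) {struct phi} : set V :=
  match phi with
  | Falsum => set0
  | Equal t u => tvars t `|` tvars u
  | Rel r u => \bigcup_i tvars (u i)
  | Imply phi psi => fvars phi `|` fvars psi
  | Forall phi => Some @^-1` fvars phi
  end.

Lemma tvars_finite (V : Type) (t : term L V) : finite_set (tvars t).
Proof.
by elim: t => //= f u IH; apply: bigcup_finite => //; exact: finite_finset.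
Qed.

Lemma fvars_finite (V : Type) (phi : formula L V) : finite_set (fvars phi).
Proof.
elim: phi => {V} //= [V t u|V r u|V p IHp q IHq|V p IH].
- by rewrite finite_setU; split; exact: tvars_finite.
- apply: bigcup_finite => [|i _]; first exact: finite_finset.
  exact: tvars_finite.
- by rewrite finite_setU.
- by apply: finite_preimage => // x y _ _ [].
Qed.

Lemma trename_eq (V : Type) W (h k : V -> W) (t : term L V) :
  (forall x, tvars t x -> h x = k x) -> trename h t = trename k t.
Proof.
elim: t => [x /= -> //|f u IH /= E].
by congr App; apply/funext => i; apply: IH => x ux; apply: E; exists i.
Qed.

Lemma frename_eq (V : Type) W (h k : V -> W) (phi : formula L V) :
  (forall x, fvars phi x -> h x = k x) -> frename h phi = frename k phi.
Proof.
elim: phi W h k => {V} //= [V t u|V r u|V p IHp q IHq|V p IH] W h k E.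
- by congr Equal; apply: trename_eq => x ?; apply: E; [left|right].
- by congr Rel; apply/funext => i; apply: trename_eq => x ?; apply: E; exists i.
- by congr Imply; [apply: IHp|apply: IHq] => x ?; apply: E; [left|right].
- by congr Forall; apply: IH => -[x px|//] /=; rewrite E.
Qed.

Lemma sat_eq (M : structure L) (V : Type) (v w : V -> M) (phi : formula L V) :
  (forall x, fvars phi x -> v x = w x) -> sat v phi -> sat w phi.
Proof.
move=> E; have Eid u : sat u phi <-> sat (@id M) (frename u phi).
  by rewrite sat_frename.
by rewrite !Eid (frename_eq E).
Qed.

End renaming.

Section type_flow.
Context {L : language} {M : structure L} {I : Type} {pX : set (formula L I)}.
Implicit Types p q : type_space M pX.

Lemma type_ext p q : type_formulas p = type_formulas q -> p = q.
Proof.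
case: p q => [p pc pe] [q qc qe] /= ?; subst q.
by congr TypeSpace; exact: Prop_irrelevance.
Qed.

Lemma type_Neg p phi : type_formulas p (Neg phi) <-> ~ type_formulas p phi.
Proof.
have [fs c] := type_complete p; split=> [pN pphi|]; last by case: (c phi).
have [] := fs [set phi; Neg phi]; first by rewrite finite_setU.
  by move=> _ [->|->].
move=> x H; have : sat (asg (@id M) x) (Neg phi) by apply: H; right.
by apply; apply: H; left.
Qed.

HB.instance Definition _ := gen_eqMixin (type_space M pX).
HB.instance Definition _ := gen_choiceMixin (type_space M pX).

(* The sets $[\phi]$ are closed under finite intersections, so that this
   subbase is in fact the usual base of clopen sets. *)
Definition type_subbase : set (set (type_space M pX)) :=
  [set U | exists phi, U = [set p | type_formulas p phi]].

HB.instance Definition _ :=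
  isSubBaseTopological.Build (type_space M pX) type_subbase id.

Lemma type_cvg (F : set_system (type_space M pX)) {FF : Filter F} p :
  (forall phi, type_formulas p phi -> F [set q | type_formulas q phi]) ->
  F --> p.
Proof.
move=> Fp; apply: (subbase_cvg (D := type_subbase)).
  move=> A [D' D'sub <-] [B D'B Bg]; exists B; first exact: D'sub.
  by split=> // h Bh; exists B.
by move=> A [phi ->] /Fp.
Qed.

Lemma type_open phi : open [set p : type_space M pX | type_formulas p phi].
Proof.
exists [set [set p : type_space M pX | type_formulas p phi]]; last first.
  by rewrite bigcup_set1.
by move=> _ ->; apply: finI_from1; exists phi.
Qed.

Lemma type_hausdorff : hausdorff_space (type_space M pX).
Proof.
move=> p q pq; apply: type_ext; apply/seteqP; split=> phi pphi.
  apply: contrapT => /type_Neg nq.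
  have [r [/= r1 /type_Neg]] := pq _ _
    (open_nbhs_nbhs (conj (type_open phi) pphi))
    (open_nbhs_nbhs (conj (type_open (Neg phi)) nq)).
  exact.
apply: contrapT => /type_Neg np.
have [r [/= /type_Neg]] := pq _ _
  (open_nbhs_nbhs (conj (type_open (Neg phi)) np))
  (open_nbhs_nbhs (conj (type_open phi) pphi)).
exact.
Qed.

Lemma type_compact : compact [set: type_space M pX].
Proof.
rewrite compact_ultra => F FU _.
pose P := [set phi | F [set p | type_formulas p phi]].
have Pc : complete_type (@id M) P.
  split=> [s sfin sP|phi]; last first.
    have [|Fn] := in_ultra_setVsetC [set p | type_formulas p phi] FU.
      by left.
    by right; apply: filterS Fn => q /= /type_Neg.
  have [p ps] : \bigcap_(phi in s) [set p : type_space M pX |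
      type_formulas p phi] !=set0.
    by apply: (@filter_ex _ F); exact: filter_finite_bigcap.
  by have [fs _] := type_complete p; exact: fs sfin ps.
have PX phi : pX phi -> P (frename inl phi).
  by move=> Xphi; apply: filterE => q; exact: type_extends.
by exists (TypeSpace Pc PX); split=> //; apply: type_cvg.
Qed.

Definition param_map (N N' : Type) (h : N -> N') (z : I + N) : I + N' :=
  match z with inl i => inl i | inr c => inr (h c) end.

Definition act_formulas (g : aut M) p : set (formula L (I + M)) :=
  [set phi | type_formulas p (frename (param_map (aut_inv g)) phi)].

Lemma act_complete g p : complete_type (@id M) (act_formulas g p).
Proof.
have [fs c] := type_complete p; split=> [s sfin sp|phi]; last exact: c.
have [|x xs] := fs _ (finite_image (frename (param_map (aut_inv g))) sfin).
  by move=> _ [phi /sp ? <-].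
exists (g \o x) => phi sphi; have := xs _ (ex_intro2 _ _ _ sphi erefl).
rewrite sat_frename -(sat_aut g).
congr (sat _ _); apply/funext => -[i|b] //=.
exact: aut_invK.
Qed.

Lemma act_extends g p phi : pX phi -> act_formulas g p (frename inl phi).
Proof.
by move=> Xphi; rewrite /act_formulas /= frename_comp; exact: type_extends.
Qed.

Definition type_act (g : aut M) p : type_space M pX :=
  TypeSpace (act_complete g p) (@act_extends g p).

Lemma type_act1 p : type_act 1%g p = p.
Proof.
apply: type_ext; apply/seteqP; split=> phi /=; rewrite /act_formulas /=;
  by rewrite (_ : param_map _ = id) ?frename_id //; apply/funext => -[].
Qed.

Lemma type_actM g h p : type_act (g * h)%g p = type_act g (type_act h p).
Proof.
apply: type_ext; apply/seteqP; split=> phi /=; rewrite /act_formulas /=;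
  rewrite /act_formulas /= frename_comp;
  by congr (type_formulas p (frename _ _)); apply/funext => -[].
Qed.

Lemma type_act_continuous :
  continuous (fun gp : aut M * type_space M pX => type_act gp.1 gp.2).
Proof.
move=> [g p] /=; apply: type_cvg => phi pphi.
pose K := inr @^-1` fvars phi : set M.
have Kfin : finite_set K.
  by apply: finite_preimage; [move=> x y _ _ []|exact: fvars_finite].
pose A := \bigcap_(b in K) [set h : aut M | aut_inv h b = aut_inv g b].
exists (A, [set q | type_formulas q (frename (param_map (aut_inv g)) phi)]).
  split=> /=.
    apply: filter_finite_bigcap => // b _.
    apply: filterS (aut_nbhs g (aut_inv g b)) => h /=.
    rewrite aut_invK => e; apply: (can_inj (aut_funK h)).
    by rewrite aut_invK e.
  by apply: open_nbhs_nbhs; split=> //; exact: type_open.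
move=> -[h q] [/= Ah]; rewrite /act_formulas /=.
congr (type_formulas q _); apply: frename_eq => -[//|b /= bphi].
by congr inr; apply/esym/Ah.
Qed.

Definition type_flow : flow := Flow type_act1 type_actM type_act_continuous
  type_compact type_hausdorff.

End type_flow.

Arguments type_flow {L} M {I} pX.

Section restriction.
Context {L : language} {M N : structure L} {j : M -> N}.
Context (hj : elementary_embedding j).
Context {I : Type} {pX : set (formula L I)}.

Lemma finite_conj (V : Type) (s : set (formula L V)) : finite_set s ->
  exists psi : formula L V, forall (K : structure L) (v : V -> K),
    sat v psi <-> forall phi, s phi -> sat v phi.
Proof.
move=> /(@finite_seqP {classic formula L V}) [l ->].
elim: l => [|phi l [psi H]].
  by exists (Neg Falsum) => K v; split=> [_ phi|_ //]; rewrite /= in_nil.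
exists (Neg (Imply phi (Neg psi))) => K v; split=> [/= nn chi|/= all].
  rewrite inE => /orP[/eqP ->|chil].
    by apply: contrapT => nphi; apply: nn => /nphi.
  by apply: contrapT => nchi; apply: nn => _ /H /(_ _ chil).
apply; first by apply: all; rewrite mem_head.
by apply/H => chi chil; apply: all; rewrite inE chil orbT.
Qed.

Lemma elementary_descent_seq (l : seq {classic I}) (phi : formula L (I + M))
    (x : I -> N) :
  (forall i : {classic I}, i \notin l -> exists c, x i = j c) ->
  sat (asg j x) phi -> exists y : I -> M, sat (asg id y) phi.
Proof.
elim: l phi x => [|i l IH] phi x xl.
  have /choice [y yE] : forall i : {classic I}, exists c, x i = j c.
    by move=> i; exact: xl.
  have -> : asg j x = j \o asg id y by apply/funext => -[k|//]; exact: yE.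
  by move=> /hj; exists y.
pose k (z : I + M) := match z with
  | inl i' => if (i' : {classic I}) == i then None else Some z
  | inr _ => Some z end.
have [c0] := dom_inhabited M.
pose x' (i' : {classic I}) := if i' == i then j c0 else x i'.
move=> xphi; have [i'||y] := IH (Neg (Forall (Neg (frename k phi)))) x'.
- rewrite /x'; case: eqP => [_ _|/eqP ne nl]; first by exists c0.
  by apply: xl; rewrite inE negb_or ne.
- move=> /(_ (x i)); apply; apply/sat_frename; move: xphi.
  congr (sat _ phi); apply/funext => -[i'|//] /=.
  have [->//|ne] := @eqVneq {classic I} i' i.
  by rewrite /= /x' (negbTE ne).
rewrite sat_Neg /= => /existsNP [c /contrapT /sat_frename yc].
exists (fun i' : {classic I} => if i' == i then c else y i').
move: yc; congr (sat _ phi); apply/funext => -[i'|//] /=.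
by case: eqP.
Qed.

Lemma elementary_descent (phi : formula L (I + M)) (x : I -> N) :
  sat (asg j x) phi -> exists y : I -> M, sat (asg id y) phi.
Proof.
have /(@finite_seqP {classic I}) [l lE] :
    finite_set (inl @^-1` fvars phi : set I).
  by apply: finite_preimage; [move=> ? ? _ _ []|exact: fvars_finite].
have [c0] := dom_inhabited M => xphi.
apply: (@elementary_descent_seq l phi
  (fun i : {classic I} => if i \in l then x i else j c0)) => [i /negbTE ->|].
  by exists c0.
apply: sat_eq xphi => -[i iphi|//] /=.
by have /= -> // : [set` l] i; rewrite -lE.
Qed.

Definition restrict_formulas (p : type_space N pX) : set (formula L (I + M)) :=
  [set phi | type_formulas p (frename (param_map j) phi)].

Lemma restrict_complete p : complete_type (@id M) (restrict_formulas p).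
Proof.
have [fs c] := type_complete p; split=> [s sfin sp|phi]; last exact: c.
have [psi psiE] := finite_conj sfin.
have [|x xs] := fs _ (finite_image (frename (param_map j)) sfin).
  by move=> _ [phi /sp ? <-].
have [|y /psiE] := @elementary_descent psi x; last by exists y.
apply/psiE => phi sphi; have /sat_frename := xs _ (ex_intro2 _ _ _ sphi erefl).
by congr (sat _ phi); apply/funext => -[].
Qed.

Lemma restrict_extends p phi : pX phi -> restrict_formulas p (frename inl phi).
Proof.
by move=> Xphi; rewrite /restrict_formulas /= frename_comp; exact: type_extends.
Qed.

Definition type_restriction (p : type_space N pX) : type_space M pX :=
  TypeSpace (restrict_complete p) (@restrict_extends p).

Definition compatible
    (F' : closed_invariant_equivalence (type_flow N pX))
    (F : closed_invariant_equivalence (type_flow M pX)) : Prop :=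
  [set (type_restriction pq.1, type_restriction pq.2) | pq in eqv_rel F'] =
  eqv_rel F.

End restriction.

Definition directed (D : Type) (le : D -> D -> Prop) : Prop :=
  [/\ inhabited D, forall i, le i i,
      forall i k l, le i k -> le k l -> le i l &
      forall i k, exists l, le i l /\ le k l].

Definition net_filter (D : Type) (le : D -> D -> Prop) : set_system D :=
  [set A | exists i, forall k, le i k -> A k].

Section ellis.
Variable Y : flow.
Implicit Types (a c u : {ptws Y -> Y}) (B M : set {ptws Y -> Y}).

Definition translation (g : flow_group Y) : {ptws Y -> Y} := flow_act g.

Definition ellis_semigroup : set {ptws Y -> Y} := closure (range translation).

Definition left_ideal M : Prop :=
  [/\ M !=set0, M `<=` ellis_semigroup &
      forall a m, ellis_semigroup a -> M m -> M (a \o m)].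

Definition minimal_left_ideal M : Prop :=
  left_ideal M /\ forall M', left_ideal M' -> M' `<=` M -> M' = M.

Definition ellis_circ a B : set {ptws Y -> Y} :=
  [set c | exists (D : Type) (le : D -> D -> Prop)
      (g : D -> flow_group Y) (b : D -> {ptws Y -> Y}),
    [/\ directed le, forall i, B (b i),
        translation (g i) @[i --> net_filter le] --> a &
        (translation (g i) \o b i : {ptws Y -> Y}) @[i --> net_filter le]
          --> c]].

Definition ellis_group M u : set {ptws Y -> Y} := [set u \o m | m in M].

Definition tau_closure M u B : set {ptws Y -> Y} :=
  ellis_group M u `&` ellis_circ u B.

Definition tau_closed M u B : Prop :=
  B `<=` ellis_group M u /\ tau_closure M u B = B.

Definition ellis_datum M u : Prop :=
  [/\ minimal_left_ideal M, M u & u \o u = u].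

End ellis.

(* Isomorphism of groups which is a homeomorphism for the tau-topologies,
   expressed on their closed sets. *)
Definition ellis_group_isomorphism (Y Z : flow)
    (M : set {ptws Y -> Y}) (u : {ptws Y -> Y})
    (N : set {ptws Z -> Z}) (v : {ptws Z -> Z})
    (f : {ptws Y -> Y} -> {ptws Z -> Z}) : Prop :=
  [/\ set_bij (ellis_group M u) (ellis_group N v) f,
      forall a b, ellis_group M u a -> ellis_group M u b ->
        f (a \o b) = f a \o f b &
      forall B, B `<=` ellis_group M u ->
        (tau_closed M u B <-> tau_closed N v (f @` B))].

(* As the Ellis group is defined only up to isomorphism, all choices of
   minimal left ideals and idempotents are considered. *)
Definition topologically_isomorphic_ellis_groups (Y Z : flow) : Prop :=
  forall M u N v, @ellis_datum Y M u -> @ellis_datum Z N v ->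
  exists f, ellis_group_isomorphism M u N v f.

(* Main.v *)
Require Import Defs.
From mathcomp Require Import all_boot finmap all_classical topology.

(** Write [r] for the restriction of types from [C'] to [C].  By saturation of
    [C] and homogeneity of [C'], every finite subset of [C'] is carried into
    [C] by an automorphism of [C'] fixing its points already in [C].  A limit
    of such automorphisms is an element [e] of the Ellis semigroup [E'] of
    [S_X(C')] whose value at a type depends only on its restriction, and with
    [r \o e = r]: thus [e = h \o r] for a (discontinuous) section [h] of [r].
    Since [e] preserves [F'], compatibility makes [h] descend to the quotients.
    Homogeneity of [C] gives [r \o x \o h] in the Ellis semigroup [E] of
    [S_X(C)] for [x] in [E'], and homogeneity of [C'] lifts translations by
    [Aut C] to [E'] along [r], so that [x |-> h \o x \o r] identifies [E] with
    [e E' e].  A minimal idempotent of [e E' e] is minimal in [E'] and has the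
    same group there.  The discontinuity of [h] is harmless for the
    tau-topology: a net [g_i b_i] witnessing [ellis_circ] is lifted through
    [r], a limit is taken by compactness, and [e] is applied on the left with
    [a o (b o B) <= (a b) o B]. *)

Set Implicit Arguments.
Unset Strict Implicit.
Unset Printing Implicit Defensive.
Local Open Scope classical_set_scope.

(** * Pointwise convergence and ultrafilters *)

Lemma comp_app (A B C : Type) (f : B -> C) (g : A -> B) (h : A -> C) :
  f \o g = h -> forall z, f (g z) = h z.
Proof. by move=> <-. Qed.

Lemma ptws_cvgP (U : Type) (V : topologicalType)
    (F : set_system {ptws U -> V}) {FF : Filter F} (f : {ptws U -> V}) :
  F --> f <-> forall t, (fun g : {ptws U -> V} => g t) @ F --> f t.
Proof.
rewrite cvg_sup; split=> H t.
  have := H t.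
  rewrite cvg_image; last by rewrite eqEsubset; split=> v // _; exists (cst v).
  apply: cvg_trans => W /=; rewrite ?nbhs_simpl /fmap /= => [[W' + <-]].
  by apply: filterS => g W'g /=; exists g.
have := H t.
rewrite cvg_image; last by rewrite eqEsubset; split=> v // _; exists (cst v).
move=> + W //=; rewrite ?nbhs_simpl => Q => /Q Q'; exists (@^~ t @^-1` W) => //.
by rewrite eqEsubset; split => [k [? + <-//]|k Wk]; exists (fun _ => k).
Qed.

Lemma cvg_ptws (D U : Type) (V : topologicalType) (F : set_system D)
    {FF : Filter F} (f : D -> {ptws U -> V}) (l : {ptws U -> V}) :
  (forall t, f i t @[i --> F] --> l t) -> f @ F --> l.
Proof. by move=> H; apply/ptws_cvgP. Qed.

Lemma ptws_eval_continuous (U : Type) (V : topologicalType) (t : U) :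
  continuous (fun g : {ptws U -> V} => g t).
Proof. by move=> f; have /ptws_cvgP := @cvg_id _ (nbhs f); exact. Qed.

Lemma ptws_comp_continuous (U U' : Type) (V V' : topologicalType)
    (k : V -> V') (w : U' -> U) : continuous k ->
  continuous (fun f : {ptws U -> V} => k \o f \o w : {ptws U' -> V'}).
Proof.
move=> kc f; apply: (@cvg_ptws _ _ _ (nbhs f)) => t.
apply: (@continuous_comp _ _ _ (fun g : {ptws U -> V} => g (w t)) k).
  exact: ptws_eval_continuous.
exact: kc.
Qed.

Lemma ultra_compact_cvg (D : Type) (V : topologicalType) (F : set_system D)
    (f : D -> V) : UltraFilter F -> compact [set: V] ->
  exists v : V, f @ F --> v.
Proof.
move=> FU /(_ (f @ F) _ filterT) [v [_ clv]].
exists v => A vA; have [//|FA] := in_ultra_setVsetC (f @^-1` A) FU.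
by have [w [nAw /nAw]] := clv (~` A) A FA vA.
Qed.

Lemma ultra_ptws_cvg (D U : Type) (V : topologicalType) (F : set_system D)
    (f : D -> {ptws U -> V}) : UltraFilter F -> compact [set: V] ->
  exists v : {ptws U -> V}, f @ F --> v.
Proof.
move=> FU cV.
have /choice[v fv] : forall t, exists v : V, (f i t) @[i --> F] --> v.
  by move=> t; exact: ultra_compact_cvg.
by exists v; exact: cvg_ptws.
Qed.

Lemma closure_continuous_image (S T : topologicalType) (f : S -> T) (A : set S)
    (B : set T) (x : S) : continuous f -> f @` A `<=` B ->
  closure A x -> closure B (f x).
Proof.
move=> fc AB Ax V /fc /= /Ax [y [Ay Vy]].
by exists (f y); split=> //; apply: AB; exists y.
Qed.

(** The demands have the finite intersection property. Applied to sets of automorphisms, this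
    supplies the limits taken below. *)
Lemma ultrafilter_of_finite_demands (T J : Type) (R : J -> set T) :
  (forall s : set J, finite_set s -> exists x, forall i, s i -> R i x) ->
  exists2 F : set_system T, UltraFilter F & forall i, F (R i).
Proof.
move=> H.
pose I := {classic J}.
have PF : ProperFilter (filter_from (finI_from [set: I] (R : I -> set T)) id).
  apply: finI_filter => D' _; have [|x xR] := H [set` D'].
    by apply/(@finite_fsetP {classic J}); exists D'.
  by exists x => i iD; exact: xR.
have [F [FU FS]] := ultraFilterLemma PF.
exists F => // i; apply: FS; exists (R i) => //.
by apply: (@finI_from1 I T [set: I] R i).
Qed.

(** * Ellis semigroups and the tau-topology *)

Section ellis_theory.
Variable Y : flow.
Local Notation E := (@ellis_semigroup Y).
Implicit Types (a b c s t u v w x y : {ptws Y -> Y}) (B : set {ptws Y -> Y}).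

Lemma flow_act_continuous (g : flow_group Y) : continuous (@flow_act Y g).
Proof.
move=> y A /(@flow_continuous Y (g, y)) [[U V] /= [gU yV] UVA].
by apply: filterS yV => z Vz; apply: (UVA (g, z)); split=> //=;
   exact: nbhs_singleton.
Qed.

Lemma ellis_comp_continuous w :
  continuous (fun x => x \o w : {ptws Y -> Y}).
Proof. by apply: (@ptws_comp_continuous Y Y Y Y id w) => ?; exact: cvg_id. Qed.

Lemma ellis_translation_continuous (g : flow_group Y) :
  continuous (fun x => translation g \o x : {ptws Y -> Y}).
Proof.
exact: (@ptws_comp_continuous Y Y Y Y (flow_act g) id (@flow_act_continuous g)).
Qed.

Lemma ellis_translation (g : flow_group Y) : E (translation g).
Proof. by apply: subset_closure; exists g. Qed.

Lemma ellis_cvg (D : Type) (F : set_system D) {FF : ProperFilter F}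
    (f : D -> {ptws Y -> Y}) a : (forall i, E (f i)) -> f @ F --> a -> E a.
Proof.
move=> Ef fa; apply: (@closed_cvg _ {ptws Y -> Y} F _ f E) fa.
  exact: closed_closure.
exact: nearW.
Qed.

Lemma ellis_id : E id.
Proof.
rewrite (_ : id = translation 1%g); first exact: ellis_translation.
by apply/funext => y; rewrite /translation flow_act1.
Qed.

(** Composition is continuous in its left factor, but in its right factor only when the left one is
    a translation. So [a] is first replaced by a translation, and only then [b]. *)
Lemma ellis_comp a b : E a -> E b -> E (a \o b).
Proof.
move=> Ea Eb; suff : closure E (a \o b) by exact: closed_closure.
apply: (closure_continuous_image (@ellis_comp_continuous b)) Ea.
move=> _ [_ [g _ <-] <-].
apply: (closure_continuous_image (@ellis_translation_continuous g)) Eb.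
move=> _ [_ [h _ <-] <-]; exists (g * h)%g => //.
by apply/funext => y; rewrite /translation flow_actM.
Qed.

(* The nets in the definition of [ellis_circ] may be taken in the Ellis
   semigroup rather than in the group. *)
Lemma ellis_circP a B c : ellis_circ a B c <->
  forall U V, nbhs a U -> nbhs c V ->
    exists x b, [/\ E x, U x, B b & V (x \o b)].
Proof.
split=> [[D [le [g [b [[_ _ le_tr dir] Bb ga gc]]]]] U V aU cV|H].
  have [i iU] := ga _ aU; have [k kV] := gc _ cV.
  have [l [il kl]] := dir i k.
  exists (translation (g l)), (b l); split=> //; last exact: kV.
    exact: ellis_translation.
  exact: iU.
(* The net is indexed by pairs of neighbourhoods of [a] and [c] under reverse inclusion. Each [x]
   given by [H] is moved to a nearby translation, as composition with [b] on the right is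
   continuous. *)
pose D := {p : set {ptws Y -> Y} * set {ptws Y -> Y} |
  nbhs a p.1 /\ nbhs c p.2}.
pose le (p q : D) := (sval q).1 `<=` (sval p).1 /\ (sval q).2 `<=` (sval p).2.
have /choice[gb gbP] : forall p : D,
    exists gb : flow_group Y * {ptws Y -> Y},
    [/\ (sval p).1 (translation gb.1), B gb.2 &
        (sval p).2 (translation gb.1 \o gb.2)].
  move=> [[U V] [/= aU cV]].
  have [x [b [Ex Ux Bb Vx]]] :=
    H U° V° (nbhs_interior aU) (nbhs_interior cV).
  have [|_ [[g _ <-] [Ug Vg]]] :=
      Ex (U `&` [set z : {ptws Y -> Y} | V (z \o b)]).
    apply: filterI => //.
    exact: (@ellis_comp_continuous b x).
  by exists (g, b).
exists D, le, (fst \o gb), (snd \o gb); split.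
- split=> [|p|p q q' [pq1 pq2] [qq1 qq2]|p q].
  + by constructor; exists (setT, setT); split; exact: filterT.
  + by split.
  + by split; [apply: subset_trans pq1|apply: subset_trans pq2].
  + have [[p1 p2] [q1 q2]] := (svalP p, svalP q).
    exists (exist _ (_, _) (conj (filterI p1 q1) (filterI p2 q2))).
    by split; split=> z [].
- by move=> p; have [] := gbP p.
- move=> A aA; exists (exist _ (A, setT) (conj aA filterT)) => p [pA _].
  by have [/pA] := gbP p.
- move=> A cA; exists (exist _ (setT, A) (conj filterT cA)) => p [_ pA].
  by have [_ _ /pA] := gbP p.
Qed.

Lemma ellis_circ_comp a b B : E a -> B b -> ellis_circ a B (a \o b).
Proof.
move=> Ea Bb; apply/ellis_circP => U V aU cV.
by exists a, b; split=> //;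
  [exact: (nbhs_singleton aU)|exact: (nbhs_singleton cV)].
Qed.

Lemma ellis_circS a B B' : B `<=` B' -> ellis_circ a B `<=` ellis_circ a B'.
Proof.
move=> BB' c /ellis_circP H; apply/ellis_circP => U V aU cV.
by have [x [b [? ? /BB' ? ?]]] := H _ _ aU cV; exists x, b.
Qed.

(** The outer net consists of translations, which are continuous: composing with one of them pulls
    neighbourhoods of [a \o b] and [c] back to neighbourhoods of [b] and [d l], where the inner
    limit applies. *)
Lemma ellis_circ_circ a b B :
  ellis_circ a (ellis_circ b B) `<=` ellis_circ (a \o b) B.
Proof.
move=> c [D [le [g [d [[_ _ le_tr dir] dB ga gc]]]]].
apply/ellis_circP => U V abU cV.
have [i iU] := ga _ (@ellis_comp_continuous b a _ (nbhs_interior abU)).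
have [k kV] := gc _ (nbhs_interior cV).
have [l [/iU gU /kV gV]] := dir i k.
have /ellis_circP/(_ _ _ (@ellis_translation_continuous (g l) b _ gU)
  (@ellis_translation_continuous (g l) (d l) _ gV)) := dB l.
move=> [x [b' [Ex Ux Bb' Vx]]].
exists (translation (g l) \o x), b'; split=> //.
by apply: ellis_comp => //; exact: ellis_translation.
Qed.

Lemma ellis_circ_right a B c w : ellis_circ a B c ->
  ellis_circ a [set b \o w | b in B] (c \o w).
Proof.
move=> /ellis_circP H; apply/ellis_circP => U V aU cV.
have [x [b [Ex Ux Bb Vx]]] := H _ _ aU (@ellis_comp_continuous w c _ cV).
by exists x, (b \o w); split=> //; exists b.
Qed.

(** For the [u] of an [ellis_datum] this is the Ellis group, described without its left ideal. *)
Definition idempotent_group u : set {ptws Y -> Y} :=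
  [set x | [/\ E x, u \o x = x & x \o u = x]].

(** The last clause puts [u] in every left ideal [E a u], which amounts to minimality of the left
    ideal [E u]. *)
Definition minimal_idempotent u : Prop :=
  [/\ E u, u \o u = u &
      forall a, E a -> exists2 s, E s & s \o (a \o u) = u].

Section datum.
Variables (M : set {ptws Y -> Y}) (u : {ptws Y -> Y}) (d : ellis_datum M u).

Lemma ellis_datum_idealE t : M t -> [set a \o t | a in E] = M.
Proof.
have [[[_ ME MM] Mmin] _ _] := d => Mt; apply: Mmin.
  split; first by exists (id \o t), id => //; exact: ellis_id.
    by move=> _ [a Ea <-]; apply: ellis_comp => //; exact: ME.
  by move=> a _ Ea [b Eb <-]; exists (a \o b) => //; exact: ellis_comp.
by move=> _ [a Ea <-]; exact: MM.
Qed.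

Lemma ellis_datum_minimal : minimal_idempotent u.
Proof.
have [[[_ ME MM] Mmin] Mu uu] := d; split=> // [|a Ea]; first exact: ME.
have := Mu; rewrite -{1}(ellis_datum_idealE (MM _ _ Ea Mu)) => -[s Es su].
by exists s.
Qed.

Lemma ellis_datum_group : ellis_group M u = idempotent_group u.
Proof.
have [[[_ ME MM] Mmin] Mu uu] := d; apply/seteqP; split=> [_ [m Mm <-]|x].
  split; first by apply: ellis_comp; exact: ME.
    by rewrite compA uu.
  move: Mm; rewrite -(ellis_datum_idealE Mu) => -[a Ea <-].
  by rewrite -2!compA uu.
move=> [Ex ux xu]; exists x => //.
by rewrite -(ellis_datum_idealE Mu); exists x.
Qed.

Lemma tau_closedP B : B `<=` idempotent_group u ->
  tau_closed M u B <->
  forall c, idempotent_group u c -> ellis_circ u B c -> B c.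
Proof.
rewrite /tau_closed /tau_closure ellis_datum_group => BG.
split=> [[_ BE] c Gc uBc|H]; first by rewrite -BE.
split=> //; apply/seteqP; split=> [c [Gc]|c Bc]; first exact: H.
have [_ uc _] := BG _ Bc; split; first exact: BG.
by rewrite -uc; apply: ellis_circ_comp => //; case: ellis_datum_minimal.
Qed.

End datum.

(* Any two minimal idempotents are linked as in a Rees matrix semigroup. *)
Lemma minimal_idempotent_link u v :
  minimal_idempotent u -> minimal_idempotent v ->
  exists s t, [/\ E s /\ E t, s \o t = u, t \o s = v,
    u \o s = s /\ s \o v = s & v \o t = t /\ t \o u = t].
Proof.
move=> [Eu uu umin] [Ev vv vmin].
have [s0 Es0 s0E] := umin v Ev.
(* Padding [s0] with [u] and [v] gives the one-sided identities without spoiling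
   [s0 \o (v \o u) = u]. *)
pose t : {ptws Y -> Y} := v \o u; pose s : {ptws Y -> Y} := u \o s0 \o v.
have Et : E t by exact: ellis_comp.
have Es : E s by apply: ellis_comp => //; exact: ellis_comp.
have uuE := comp_app uu; have vvE := comp_app vv.
have s0EE (y : Y) : s0 (v (u y)) = u y := comp_app s0E y.
have us : u \o s = s by apply/funext => y; rewrite /s /= uuE.
have sv : s \o v = s by apply/funext => y; rewrite /s /= vvE.
have vt : v \o t = t by apply/funext => y; rewrite /t /= vvE.
have tu : t \o u = t by apply/funext => y; rewrite /t /= uuE.
have st : s \o t = u by apply/funext => y; rewrite /s /t /= vvE s0EE uuE.
exists s, t; split=> //; apply/funext => y.
(* As [s \o t = u], the map [t \o s] is idempotent; [s1] inverts it on the left up to [v], which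
   forces [t \o s = v]. *)
have [s1 Es1 s1E] := vmin _ (ellis_comp Et Es).
have s1EE (z : Y) : s1 (t (s z)) = v z.
  by rewrite -(comp_app sv); exact: comp_app s1E z.
by rewrite /= -(comp_app vt) -s1EE (comp_app st) (comp_app us) s1EE.
Qed.

End ellis_theory.

(* Preserving [ellis_circ] is what makes a homomorphism continuous for the
   tau-topologies. *)
Definition ellis_morphism (Y Z : flow) (u : {ptws Y -> Y}) (v : {ptws Z -> Z})
    (f : {ptws Y -> Y} -> {ptws Z -> Z}) : Prop :=
  [/\ forall x, idempotent_group u x -> idempotent_group v (f x),
      forall x y, idempotent_group u x -> idempotent_group u y ->
        f (x \o y) = f x \o f y &
      forall B c, B `<=` idempotent_group u -> idempotent_group u c ->
        ellis_circ u B c -> ellis_circ v (f @` B) (f c)].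

Lemma ellis_morphism_comp (X Y Z : flow) (u : {ptws X -> X})
    (v : {ptws Y -> Y}) (w : {ptws Z -> Z}) f g :
  ellis_morphism u v f -> ellis_morphism v w g -> ellis_morphism u w (g \o f).
Proof.
move=> [fG fM fc] [gG gM gc]; split=> [x /fG /gG //|x y Gx Gy|B c BG Gc uBc].
  by rewrite /= fM // gM //; exact: fG.
rewrite -(image_comp f g B); apply: gc; [|exact: fG|exact: fc].
by move=> _ [b /BG Gb <-]; exact: fG.
Qed.

(** Closedness is tested on limit points: [f] sends those of [B] to limit points of its image, and
    [g] brings the latter back. *)
Lemma ellis_morphism_isomorphism (Y Z : flow) (M : set {ptws Y -> Y})
    (u : {ptws Y -> Y}) (N : set {ptws Z -> Z}) (v : {ptws Z -> Z}) f g :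
  ellis_datum M u -> ellis_datum N v ->
  ellis_morphism u v f -> ellis_morphism v u g ->
  (forall x, idempotent_group u x -> g (f x) = x) ->
  (forall y, idempotent_group v y -> f (g y) = y) ->
  ellis_group_isomorphism M u N v f.
Proof.
move=> du dv [fG fM fc] [gG gM gc] fK gK; split.
- rewrite (ellis_datum_group du) (ellis_datum_group dv); split=> //.
    by move=> x y; rewrite !inE => Gx Gy fxy; rewrite -(fK x) // fxy fK.
  by move=> y Gy; exists (g y); [exact: gG|exact: gK].
- by rewrite (ellis_datum_group du).
rewrite (ellis_datum_group du) => B BG.
have fBG : f @` B `<=` idempotent_group v.
  by move=> _ [b /BG Gb <-]; exact: fG.
rewrite (tau_closedP du BG) (tau_closedP dv fBG).
split=> cl c Gc uBc.
  exists (g c); last exact: gK.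
  apply: cl; first exact: gG.
  have := gc _ _ fBG Gc uBc; apply: ellis_circS => _ [_ [b Bb <-] <-].
  by rewrite fK //; exact: BG.
have [b Bb fbc] := cl _ (fG _ Gc) (fc _ _ BG Gc uBc).
by rewrite -(fK _ Gc) -fbc fK //; exact: BG.
Qed.

Lemma ellis_morphism_conj (Y : flow) (u v s t : {ptws Y -> Y}) :
  ellis_semigroup s -> ellis_semigroup t -> s \o t = u -> t \o s = v ->
  u \o s = s -> s \o v = s -> v \o t = t -> t \o u = t ->
  ellis_morphism u v (fun x => t \o x \o s).
Proof.
move=> Es Et st ts us sv vt tu; split.
- move=> x [Ex ux xu]; split.
  + by apply: ellis_comp => //; exact: ellis_comp.
  + by apply/funext => z; rewrite /= (comp_app vt).
  + by apply/funext => z; rewrite /= (comp_app sv).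
- move=> x y [Ex ux xu] [Ey uy yu]; apply/funext => z.
  by rewrite /= (comp_app st) (comp_app uy).
move=> B c BG [Ec uc cu] uBc; rewrite -ts.
apply: ellis_circ_circ.
(* Since [b \o s = s \o (t \o b \o s)], each [b \o s] lies in [ellis_circ s] of the image of [B];
   this accounts for the factor [s] of [v = t \o s]. *)
have : ellis_circ (t \o u) [set b \o s | b in B] (t \o (c \o s)).
  apply: ellis_circ_circ; apply: ellis_circ_comp => //.
  exact: ellis_circ_right.
rewrite tu; apply: ellis_circS => _ [b Bb <-].
have [_ ub _] := BG _ Bb.
rewrite (_ : b \o s = s \o (t \o b \o s)).
  by apply: ellis_circ_comp => //; exists b.
by apply/funext => z; rewrite /= (comp_app st) (comp_app ub).
Qed.

(** * Ellis groups along a retraction of flows *)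

Section retraction.
Variables (Y' Y : flow) (r : Y' -> Y) (h : Y -> Y').
Hypothesis r_continuous : continuous r.
Hypothesis hK : cancel h r.
Hypothesis ellis_hr : @ellis_semigroup Y' (h \o r).
Hypothesis ellis_rh :
  forall a, @ellis_semigroup Y' a -> @ellis_semigroup Y (r \o a \o h).
Hypothesis translation_lift : forall g : flow_group Y,
  exists2 a, @ellis_semigroup Y' a & r \o a = flow_act g \o r.

Let rho (a : {ptws Y' -> Y'}) : {ptws Y -> Y} := r \o a \o h.
Let iota (a : {ptws Y -> Y}) : {ptws Y' -> Y'} := h \o a \o r.

Lemma rho_continuous : continuous rho.
Proof. exact: ptws_comp_continuous. Qed.

(** The translations of the net are lifted along [r], and limits upstairs exist along an ultrafilter
    refining the net. Continuity of [r] identifies these limits only after applying [r]: as [h] may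
    be discontinuous, [d] need not be [iota c]. *)
Lemma circ_lift (v : {ptws Y -> Y}) B c : ellis_circ v B c ->
  exists a d, [/\ ellis_semigroup a, r \o a = v \o r, r \o d = c \o r &
    ellis_circ a (iota @` B) d].
Proof.
move=> [D [le [g [b [[D0 le_refl le_tr dir] Bb gv gc]]]]].
have PF : ProperFilter (net_filter le).
  split=> [[i /(_ i (le_refl i))]//|]; split.
  - by case: D0 => i; exists i.
  - move=> P Q [i iP] [k kQ]; have [l [il kl]] := dir i k.
    exists l => m lm; split; [apply: iP|apply: kQ]; exact: le_tr lm.
  - by move=> P Q PQ [i iP]; exists i => k /iP /PQ.
have [F [FU FS]] := ultraFilterLemma PF.
have /choice[a aP] : forall i, exists a : {ptws Y' -> Y'},
    ellis_semigroup a /\ r \o a = flow_act (g i) \o r.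
  by move=> i; have [a Ea ra] := translation_lift (g i); exists a.
have [a0 aa0] := ultra_ptws_cvg a FU (@flow_compact Y').
have [d dd] := ultra_ptws_cvg (fun i => a i \o iota (b i) : {ptws Y' -> Y'}) FU
  (@flow_compact Y').
have lim (T : Type) (e : D -> {ptws T -> Y'}) (k : D -> {ptws Y -> Y})
    (e0 : {ptws T -> Y'}) (k0 : {ptws Y -> Y}) (q : T -> Y) :
    e @ F --> e0 -> k @ F --> k0 ->
    (forall i z, r (e i z) = k i (q z)) -> r \o e0 = k0 \o q.
  move=> ee0 kk0 E; apply/funext => z /=.
  apply: (@cvg_unique _ (@flow_hausdorff Y) (k i (q z) @[i --> F])).
    rewrite -(_ : (fun i => r (e i z)) = (fun i => k i (q z))); last first.
      by apply/funext => i.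
    apply: (@cvg_comp _ _ _ (fun i => e i z) r); last exact: r_continuous.
    exact: (cvg_comp _ _ ee0 (@ptws_eval_continuous _ _ z e0)).
  exact: (cvg_comp _ _ kk0 (@ptws_eval_continuous _ _ (q z) k0)).
exists a0, d; split.
- by apply: ellis_cvg aa0 => i; case: (aP i).
- apply: (lim _ a (fun i => translation (g i))) aa0 _ _ => [A /gv|i z].
    exact: FS.
  exact: comp_app (aP i).2 z.
- apply: (lim _ _ (fun i => translation (g i) \o b i : {ptws Y -> Y})) dd _ _.
    by move=> A /gc; exact: FS.
  by move=> i z; rewrite /iota /= (comp_app (aP i).2) /= hK.
apply/ellis_circP => U V aU dV.
have [i [Ui Vi]] : exists i, U (a i) /\ V (a i \o iota (b i)).
  by have [i] := filter_ex (filterI (aa0 _ aU : F _) (dd _ dV : F _)); exists i.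
exists (a i), (iota (b i)); split=> //; first by case: (aP i).
by exists (b i).
Qed.

Lemma ellis_iota a : ellis_semigroup a -> ellis_semigroup (iota a).
Proof.
(* The constant choice [id] turns [circ_lift] into a lifting of [a] itself to some [b] with
   [r \o b = a \o r]. *)
move=> Ea; have [|b [_ [Eb rb _ _]]] := @circ_lift a [set id] a.
  apply/ellis_circP => U V aU aV; exists a, id; split=> //.
    exact: nbhs_singleton aU.
  exact: nbhs_singleton aV.
rewrite (_ : iota a = (h \o r) \o (b \o (h \o r))).
  by apply: ellis_comp => //; exact: ellis_comp.
by apply/funext => z; rewrite /= (comp_app rb) /= hK.
Qed.

Lemma iota_minimal v : minimal_idempotent v -> minimal_idempotent (iota v).
Proof.
move=> [Ev vv vmin]; split; first exact: ellis_iota.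
  by apply/funext => z; rewrite /iota /= hK (comp_app vv).
(* Minimality of [v] is applied to the compression [r \o a \o h]. *)
move=> a Ea; have [s Es sE] := vmin _ (ellis_rh Ea).
exists (iota s); first exact: ellis_iota.
apply/funext => z; rewrite /iota /=; congr h.
exact: (comp_app sE).
Qed.

Lemma iota_morphism v : ellis_morphism v (iota v) iota.
Proof.
split=> [x [Ex vx xv]|x y _ _|B c BG [Ec vc cv] vBc].
- split; first exact: ellis_iota.
    by apply/funext => z; rewrite /iota /= hK (comp_app vx).
  by apply/funext => z; rewrite /iota /= hK (comp_app xv).
- by apply/funext => z; rewrite /iota /= hK.
have [a [d [Ea ra rd dc]]] := circ_lift vBc.
(* Left composition with [h \o r] corrects both lifted limits at once, and [ellis_circ_circ] allows
   it although [h \o r] may be discontinuous. *)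
rewrite (_ : iota v = (h \o r) \o a); last first.
  by apply/funext => z; rewrite /= (comp_app ra).
rewrite (_ : iota c = (h \o r) \o d); last first.
  by apply/funext => z; rewrite /= (comp_app rd).
by apply: ellis_circ_circ; exact: ellis_circ_comp.
Qed.

(** Such [x] takes values in the range of [h], where [h \o r] is the identity. This makes [rho]
    multiplicative on the group. *)
Lemma iota_groupK v x : idempotent_group (iota v) x ->
  forall z, h (r (x z)) = x z.
Proof.
move=> [_ vx _] z.
by rewrite -{1}(comp_app vx) /iota /= hK; exact: comp_app vx z.
Qed.

Lemma iota_rhoK v x : idempotent_group (iota v) x -> iota (rho x) = x.
Proof.
move=> Gx; have [_ _ xv] := Gx; apply/funext => z; rewrite /iota /rho /=.
rewrite (iota_groupK Gx) -(comp_app xv) /iota /= hK.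
exact: comp_app xv z.
Qed.

Lemma rho_morphism v : ellis_morphism (iota v) v rho.
Proof.
split=> [x [Ex vx xv]|x y Gx Gy|B c BG Gc vBc].
- split; first exact: ellis_rh.
    apply/funext => z; rewrite /rho /= -[in RHS](comp_app vx).
    by rewrite /iota /= hK.
  apply/funext => z; rewrite /rho /= -[x (h z)](comp_app xv).
  by rewrite /iota /= hK.
- by apply/funext => z; rewrite /rho /= (iota_groupK Gy).
(* Here neighbourhoods can be pulled back directly: [rho] is continuous because [h] occurs only on
   the right. *)
apply/ellis_circP => U V vU cV.
have rv : rho (iota v) = v by apply/funext => z; rewrite /rho /iota /= !hK.
rewrite -{}rv in vU.
have [x [b [Ex Ux Bb Vx]]] := (ellis_circP _ _ _).1 vBc _ _
  (@rho_continuous (iota v) U vU) (@rho_continuous c V cV).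
exists (rho x), (rho b); split; [exact: ellis_rh|exact: Ux|by exists b|].
rewrite (_ : _ \o _ = rho (x \o b)) //.
by apply/funext => z; rewrite /rho /= (iota_groupK (BG _ Bb)).
Qed.

Lemma retraction_ellis_groups : topologically_isomorphic_ellis_groups Y' Y.
Proof.
move=> M u N v du dv.
have [s [t [[Es Et] st ts [us sv] [vt tu]]]] := minimal_idempotent_link
  (ellis_datum_minimal du) (iota_minimal (ellis_datum_minimal dv)).
(* The group of [u] is first conjugated onto that of [iota v], then compressed to that of [v]. *)
pose f := rho \o (fun x => t \o x \o s : {ptws Y' -> Y'}).
pose g := (fun x => s \o x \o t : {ptws Y' -> Y'}) \o iota.
have cf := ellis_morphism_conj Es Et st ts us sv vt tu.
exists f; apply: (ellis_morphism_isomorphism (g := g)) du dv _ _ _ _.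
- exact: ellis_morphism_comp cf (@rho_morphism v).
- apply: ellis_morphism_comp (@iota_morphism v) _.
  exact: ellis_morphism_conj Et Es ts st vt tu us sv.
- move=> x Gx; have [cG _ _] := cf; have [_ ux xu] := Gx.
  rewrite /g /f /= (iota_rhoK (cG _ Gx)); apply/funext => z.
  by rewrite /= !(comp_app st) (comp_app xu) (comp_app ux).
- move=> y [Ey vy yv]; rewrite /f /g /=; apply/funext => z.
  rewrite /rho /= (comp_app ts) (comp_app ts) /iota /= !hK.
  by rewrite (comp_app yv) (comp_app vy).
Qed.

End retraction.

(** * Passage to quotient flows *)

Lemma ellis_eqv (Y : flow) (F : closed_invariant_equivalence Y) a x y :
  @ellis_semigroup Y a -> eqv_rel F (x, y) -> eqv_rel F (a x, a y).
Proof.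
move=> Ea Fxy; apply: contrapT => nF.
have : nbhs (a x, a y) (~` eqv_rel F).
  by apply: open_nbhs_nbhs; split=> //; exact/closed_openC/eqv_closed.
move=> -[[A B] /= [xA yB] AB].
have [|_ [[g _ <-] [Ag Bg]]] :=
    Ea ([set b : {ptws Y -> Y} | A (b x)] `&`
        [set b : {ptws Y -> Y} | B (b y)]).
  by apply: filterI; [exact: (@ptws_eval_continuous _ _ x a)|
                      exact: (@ptws_eval_continuous _ _ y a)].
by apply: (AB (flow_act g x, flow_act g y)) => //; exact: eqv_invariant.
Qed.

Lemma ellis_quotient (Y : flow) (F : closed_invariant_equivalence Y) a :
  @ellis_semigroup Y a ->
  @ellis_semigroup (quotient_flow F) (@eqv_proj Y F \o a \o @eqv_repr Y F).
Proof.
apply: (@closure_continuous_image {ptws Y -> Y}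
  {ptws eqv_quotient F -> eqv_quotient F}
  (fun a => @eqv_proj Y F \o a \o @eqv_repr Y F)).
  exact: ptws_comp_continuous (@eqv_proj_continuous Y F).
by move=> _ [_ [g _ <-] <-]; exists g.
Qed.

Section quotient_retraction.
Variables (Y' Y : flow) (r : Y' -> Y) (h : Y -> Y').
Variables (F' : closed_invariant_equivalence Y')
  (F : closed_invariant_equivalence Y).
Hypothesis r_continuous : continuous r.
Hypothesis hK : cancel h r.
Hypothesis rF : forall x y, eqv_rel F' (x, y) -> eqv_rel F (r x, r y).
Hypothesis hF : forall x y, eqv_rel F (x, y) -> eqv_rel F' (h x, h y).
Hypothesis ellis_hr : @ellis_semigroup Y' (h \o r).
Hypothesis ellis_rh : forall g : flow_group Y',
  @ellis_semigroup Y (r \o flow_act g \o h).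
Hypothesis translation_lift : forall g : flow_group Y,
  exists2 a, @ellis_semigroup Y' a & r \o a = flow_act g \o r.

Let qr : quotient_flow F' -> quotient_flow F :=
  @eqv_proj Y F \o r \o @eqv_repr Y' F'.
Let qh : quotient_flow F -> quotient_flow F' :=
  @eqv_proj Y' F' \o h \o @eqv_repr Y F.

Lemma quotient_r_proj x : qr (eqv_proj F' x) = eqv_proj F (r x).
Proof. by apply/eqv_projE/rF/eqv_projE; rewrite eqv_reprK. Qed.

Lemma quotient_h_proj y : qh (eqv_proj F y) = eqv_proj F' (h y).
Proof. by apply/eqv_projE/hF/eqv_projE; rewrite eqv_reprK. Qed.

Lemma quotient_r_continuous : continuous qr.
Proof.
apply/quotient_continuous.
have -> : qr \o \pi_(eqv_quotient F')%qT = @eqv_proj Y F \o r.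
  by apply/funext => x; exact: quotient_r_proj.
by move=> x; apply: continuous_comp; [exact: r_continuous|
                                      exact: eqv_proj_continuous].
Qed.

Lemma quotient_retraction_ellis_groups :
  topologically_isomorphic_ellis_groups (quotient_flow F') (quotient_flow F).
Proof.
apply: (@retraction_ellis_groups (quotient_flow F') (quotient_flow F) qr qh).
- exact: quotient_r_continuous.
- by move=> q; rewrite [LHS]quotient_r_proj hK eqv_reprK.
- rewrite (_ : qh \o qr = @eqv_proj Y' F' \o (h \o r) \o @eqv_repr Y' F').
    exact: ellis_quotient.
  by apply/funext => q; exact: quotient_h_proj.
(* By continuity in [a] only translations matter, and for these the map is induced by
   [r \o flow_act g \o h]. *)
- move=> a Ea; suff : closure (@ellis_semigroup (quotient_flow F))
    (qr \o a \o qh) by exact: closed_closure.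
  apply: (@closure_continuous_image
      {ptws quotient_flow F' -> quotient_flow F'}
      {ptws quotient_flow F -> quotient_flow F} (fun a => qr \o a \o qh)) Ea.
    exact: ptws_comp_continuous quotient_r_continuous.
  move=> _ [_ [g _ <-] <-].
  rewrite (_ : _ \o _ =
      @eqv_proj Y F \o (r \o @flow_act Y' g \o h) \o @eqv_repr Y F).
    exact: ellis_quotient.
  apply/funext => q; rewrite /translation /=.
  by rewrite -quotient_r_proj; congr qr; exact: eqv_act_proj.
move=> g; have [a Ea ra] := translation_lift g.
exists (@eqv_proj Y' F' \o a \o @eqv_repr Y' F'); first exact: ellis_quotient.
apply/funext => q; rewrite /= quotient_r_proj (comp_app ra).
by rewrite /= eqv_act_proj.
Qed.

End quotient_retraction.

(** * Restriction of types *)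

Lemma elementary_embedding_inj (L : language) (M N : structure L) (j : M -> N) :
  elementary_embedding j -> injective j.
Proof.
move=> hj x y jxy.
have [_] := hj bool (fun b => if b then x else y)
  (Equal (Var true) (Var false)).
exact.
Qed.

Lemma homogeneous_on_finite (L : language) (M : structure L) (V : Type)
    (K : set V) (a b : V -> M) :
  strongly_aleph0_homogeneous M -> finite_set K ->
  (forall n (f : 'I_n -> V), (forall i, K (f i)) ->
    forall phi : formula L 'I_n, sat (a \o f) phi <-> sat (b \o f) phi) ->
  exists g : aut M, forall x, K x -> g (a x) = b x.
Proof.
move=> hM /(@finite_seqP {classic V}) [l ->] ab.
pose f (i : 'I_(size l)) : V := tnth (in_tuple l) i.
have [i|g gE] := hM _ (a \o f) (b \o f) (ab _ f _).
  exact: mem_tnth.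
exists g => x xl; have xi : (index (x : {classic V}) l < size l)%N.
  by rewrite index_mem.
have := gE (Ordinal xi); rewrite /= /f (tnth_nth (x : {classic V})) /=.
by rewrite nth_index.
Qed.

Section parameters.
Context {L : language} {I : Type}.

Definition params (M : Type) (phi : formula L (I + M)) : set M :=
  inr @^-1` fvars phi.

Lemma params_finite (M : Type) (phi : formula L (I + M)) :
  finite_set (params phi).
Proof.
by apply: finite_preimage; [move=> x y _ _ []|exact: fvars_finite].
Qed.

Lemma frename_param_eq (M N : Type) (f g : M -> N) (phi : formula L (I + M)) :
  (forall c, params phi c -> f c = g c) ->
  frename (param_map f) phi = frename (param_map g) phi.
Proof.
by move=> fg; apply: frename_eq => -[//|c /fg] /= ->.
Qed.

Lemma frename_param_comp (M N P : Type) (f : N -> P) (g : M -> N)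
    (phi : formula L (I + M)) :
  frename (param_map f) (frename (param_map g) phi) =
  frename (param_map (f \o g)) phi.
Proof.
by rewrite frename_comp; congr (frename _ _); apply/funext => -[].
Qed.

End parameters.

(** * Limits of automorphisms acting on types *)

Section type_limits.
Context {L : language} {M : structure L} {I : Type} {pX : set (formula L I)}.
Local Notation S := (type_space M pX).

Lemma type_eq_sub (p q : S) :
  (forall phi, type_formulas p phi -> type_formulas q phi) -> p = q.
Proof.
move=> pq; apply: type_ext; apply/seteqP; split=> // phi qphi.
by apply: contrapT => /type_Neg /pq /type_Neg.
Qed.

Lemma ultra_limit_ellis (F : set_system (aut M)) : UltraFilter F ->
  exists2 e : S -> S, @ellis_semigroup (type_flow M pX) e &
    forall p phi, type_formulas (e p) phi <->
      F [set g | type_formulas p (frename (param_map (aut_inv g)) phi)].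
Proof.
move=> FU.
have [e eF] := @ultra_ptws_cvg (aut M) S S F (@type_act L M I pX) FU
  (@type_compact L M I pX).
(* The set of types containing [phi] is open; applying this to [Neg phi] as well gives the
   converse. *)
have sub p phi : type_formulas (e p) phi ->
    F [set g | type_formulas p (frename (param_map (aut_inv g)) phi)].
  move=> ephi; apply: (eF [set a : {ptws S -> S} | type_formulas (a p) phi]).
  apply: (@ptws_eval_continuous S S p e [set q | type_formulas q phi]).
  by apply: open_nbhs_nbhs; split=> //; exact: type_open.
exists e.
  apply: (@ellis_cvg (type_flow M pX) _ F) eF => g.
  exact: (@ellis_translation (type_flow M pX)).
move=> p phi; split=> [|Fphi]; first exact: sub.
apply: contrapT => /type_Neg /sub FN.
by have [g [/= + /type_Neg]] := filter_ex (filterI Fphi FN); exact.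
Qed.

(** A basic neighbourhood of [t] constrains only finitely many pairs of a type and a formula. *)
Lemma type_ellisP (t : S -> S) :
  (forall D : set (S * formula L (I + M)), finite_set D ->
    exists g : aut M, forall p phi, D (p, phi) -> type_formulas (t p) phi ->
      type_formulas p (frename (param_map (aut_inv g)) phi)) ->
  @ellis_semigroup (type_flow M pX) t.
Proof.
move=> H.
have [D Dfin|F FU FR] := @ultrafilter_of_finite_demands (aut M)
    (S * formula L (I + M)) (fun pphi => [set g |
      type_formulas (t pphi.1) pphi.2 ->
      type_formulas pphi.1 (frename (param_map (aut_inv g)) pphi.2)]).
  by have [g gD] := H D Dfin; exists g => -[p phi]; exact: gD.
apply: (@ellis_cvg (type_flow M pX) _ F _ (@type_act L M I pX)) => [g|].
  exact: (@ellis_translation (type_flow M pX)).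
apply: cvg_ptws => p; apply: type_cvg => phi tphi.
by apply: (@filterS _ F _ _ _ _ (FR (p, phi))) => g; exact.
Qed.

End type_limits.

(** * A section of the restriction map from limits of automorphisms *)

Section restriction_retraction.
Context {L : language} {C C' : structure L} {j : C -> C'}.
Context (hj : elementary_embedding j).
Context {I : Type} {pX : set (formula L I)}.
Local Notation Y' := (type_flow C' pX).
Local Notation Y := (type_flow C pX).
Local Notation r := (@type_restriction L C C' j hj I pX).

Lemma type_restriction_continuous : continuous (r : Y' -> Y).
Proof.
move=> p; apply: (@type_cvg _ _ _ _ (r @ nbhs p)) => phi rphi.
by apply: open_nbhs_nbhs; split=> //; exact: type_open.
Qed.

Lemma restriction_translation_lift (g : aut C) :
  strongly_aleph0_homogeneous C' ->
  exists2 a, @ellis_semigroup Y' a & r \o a = type_act g \o r.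
Proof.
move=> homC'.
(* No extension of [g] to [C'] is assumed, but homogeneity of [C'] extends it on any finite set of
   parameters, and a formula involves only finitely many. *)
have [K Kfin|F FU FR] := @ultrafilter_of_finite_demands (aut C') C
    (fun c => [set s | aut_inv s (j c) = j (aut_inv g c)]).
  have [n f _ phi|s sE] :=
      @homogeneous_on_finite _ _ C K (j \o aut_inv g) j homC' Kfin.
    rewrite -(hj (aut_inv g \o f)) -(hj f).
    exact: (@sat_aut L C (aut_opp g)).
  exists s => c Kc /=; rewrite -(sE _ Kc) /=.
  by rewrite aut_funK.
have [a Ea aE] := @ultra_limit_ellis _ _ I pX F FU.
exists a => //; apply/funext => p; apply: type_eq_sub => phi /= /aE Fphi.
have FK : F (\bigcap_(c in params phi)
    [set s : aut C' | aut_inv s (j c) = j (aut_inv g c)]).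
  by apply: filter_finite_bigcap => //; exact: params_finite.
have [s [/= + sE]] := filter_ex (filterI Fphi FK).
rewrite /act_formulas /= /restrict_formulas /= !frename_param_comp.
by rewrite (frename_param_eq (g := j \o aut_inv g)).
Qed.

(** The inverse of [s] moves [c'] into [C], and fixes it if it is already there. The inverse is used
    because it is what renames parameters in the action on types. *)
Definition pulls_back (c' : C') : set (aut C') :=
  [set s | exists2 d, aut_inv s c' = j d & forall c, c' = j c -> d = c].

Lemma pulls_back_finite (K : set C') :
  aleph0_saturated C -> strongly_aleph0_homogeneous C' -> finite_set K ->
  exists s, forall c', K c' -> pulls_back c' s.
Proof.
move=> satC homC' /(@finite_seqP {classic C'}) [l ->].
pose b (i : 'I_(size l)) : C' := tnth (in_tuple l) i.
have [c0] := dom_inhabited C.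
(* The parameters [a] are the points of the tuple [b] lying in [C], with the default [c0] at the
   other indices. The type of [b] over [a] is finitely satisfiable in [C] by elementarity, hence
   realized by some [x]. *)
have /choice[a aE] : forall i, exists c, forall c1, b i = j c1 -> c = c1.
  move=> i; have [[c bc]|nb] := pselect (exists c, b i = j c).
    exists c => c1; rewrite bc.
    exact: elementary_embedding_inj hj _ _.
  by exists c0 => c1 bc1; case: nb; exists c1.
pose p := [set phi : formula L ('I_(size l) + 'I_(size l)) |
  sat (asg (j \o a) b) phi].
have [|x xp] := satC _ _ a p.
  split=> [s sfin sp|phi]; last exact: EM.
  have [psi psiE] := finite_conj sfin.
  have [|y /sat_frename yE] := @elementary_descent _ _ _ _ hj _
      (frename (param_map a) psi) b.
    apply/sat_frename; have /psiE := sp.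
    by congr (sat _ psi); apply/funext => -[].
  exists y; apply/psiE; move: yE.
  by congr (sat _ psi); apply/funext => -[].
have xpE phi : sat (asg a x) phi <-> sat (asg (j \o a) b) phi.
  split=> [xphi|]; last exact: xp.
  by apply: contrapT => nphi; exact: (xp (Neg phi) nphi).
(* Homogeneity is applied to the joint tuples, so that [s] sends [x] to [b] and fixes [a]. *)
have [n f _ phi|s sE] := @homogeneous_on_finite _ _
    ('I_(size l) + 'I_(size l))%type setT (j \o asg a x) (asg (j \o a) b)
    homC' finite_finset.
  rewrite -(hj (asg a x \o f)) -!sat_frename.
  exact: xpE.
exists s => c' c'l; have ci : (index (c' : {classic C'}) l < size l)%N.
  by rewrite index_mem.
pose i := Ordinal ci.
have bi : b i = c'.
  by rewrite /b (tnth_nth (c' : {classic C'})) /= nth_index.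
have sx : s (j (x i)) = c' by rewrite -bi; exact: (sE (inl i)).
exists (x i) => [|c c'c]; first by rewrite -sx aut_funK.
have ac : a i = c by apply: aE; rewrite bi.
have sa : s (j (a i)) = j (a i) by exact: (sE (inr i)).
rewrite -ac; apply: (elementary_embedding_inj hj).
by apply: (can_inj (aut_funK s)); rewrite sx sa ac.
Qed.

Lemma restriction_section (sec : Y -> Y') : cancel sec r ->
  aleph0_saturated C -> strongly_aleph0_homogeneous C ->
  strongly_aleph0_homogeneous C' ->
  exists h : Y -> Y', [/\ cancel h r, @ellis_semigroup Y' (h \o r) &
    forall g : aut C', @ellis_semigroup Y (r \o type_act g \o h)].
Proof.
move=> secK satC homC homC'.
have [K Kfin|F FU FR] := @ultrafilter_of_finite_demands (aut C') C' pulls_back.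
  exact: pulls_back_finite.
have [e Ee eE] := @ultra_limit_ellis _ _ I pX F FU.
(* For a formula over [C], almost every [s] fixes all its parameters. *)
have re p : r (e p) = r p.
  apply: type_eq_sub => phi /= /eE Fphi.
  have FK : F (\bigcap_(c in params phi) pulls_back (j c)).
    by apply: filter_finite_bigcap => //; exact: params_finite.
  have [s [/= + sE]] := filter_ex (filterI Fphi FK).
  rewrite /restrict_formulas /= frename_param_comp.
  rewrite (frename_param_eq (g := j)) //.
  by move=> c /sE [d /= -> /(_ c erefl) ->].
(* For any formula, almost every [s] pulls its parameters into [C], where only the restriction of
   the type is consulted. *)
have er p q : r p = r q -> e p = e q.
  move=> rpq; apply: type_eq_sub => phi /eE Fphi; apply/eE.
  have FK : F (\bigcap_(c in params phi) pulls_back c).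
    by apply: filter_finite_bigcap => //; exact: params_finite.
  apply: filterS (filterI Fphi FK) => s [/= sphi sE].
  have /choice[d dE] : forall c, exists d, params phi c -> aut_inv s c = j d.
    have [c0] := dom_inhabited C => c.
    have [/sE [d dc _]|nc] := pselect (params phi c); first by exists d.
    by exists c0.
  move: sphi; rewrite (frename_param_eq (g := j \o d)) //.
  rewrite -frename_param_comp => sphi.
  by have : type_formulas (r q) (frename (param_map d) phi) by rewrite -rpq.
exists (e \o sec); split.
- by move=> p; rewrite /= re.
- rewrite (_ : _ \o _ = e) //; apply/funext => p /=.
  by apply: er; rewrite secK.
move=> g; apply: type_ellisP => D Dfin.
pose K := \bigcup_(d in D) params d.2.
have Kfin : finite_set K.
  by apply: bigcup_finite => // d _; exact: params_finite.
pose Q (d : Y * formula L (I + C)) := [set s : aut C' |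
  type_formulas (r (type_act g (e (sec d.1)))) d.2 ->
  type_formulas (sec d.1)
    (frename (param_map (aut_inv s \o aut_inv g \o j)) d.2)].
have FQ : F (\bigcap_(d in D) Q d).
  apply: filter_finite_bigcap => // -[p phi] _.
  have [tphi|nphi] :=
      pselect (type_formulas (r (type_act g (e (sec p)))) phi); last first.
    by apply: filterE => s /nphi.
  have := tphi; rewrite /= /restrict_formulas /= /act_formulas /=.
  move=> /eE; apply: filterS => s /= + _.
  by rewrite !frename_param_comp.
have FK : F (\bigcap_(c in K) pulls_back (aut_inv g (j c))).
  by apply: filter_finite_bigcap.
(* One [s] serves all of [D]. The automorphism [aut_mul g s] sends [j (d c)] to [j c], so [d]
   preserves types on [K], and homogeneity of [C] turns it into the inverse of some [k]. *)
have [s [sQ sK]] := filter_ex (filterI FQ FK).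
have /choice[d dE] : forall c, exists d, K c ->
    aut_inv s (aut_inv g (j c)) = j d.
  move=> c; have [/sK [d dc _]|nc] := pselect (K c); first by exists d.
  by exists c.
have [n f fK phi|k kE] := @homogeneous_on_finite _ _ C K d id homC Kfin.
  rewrite (hj (d \o f)) (hj (id \o f)).
  rewrite -(@sat_aut L C' (aut_opp (aut_mul g s)) _ (j \o (id \o f))).
  rewrite (_ : j \o (d \o f) = aut_opp (aut_mul g s) \o (j \o (id \o f))) //.
  by apply/funext => i; rewrite /= dE.
exists k => p phi Dp tphi.
have := sQ _ Dp tphi; rewrite /= (frename_param_eq (g := j \o d)); last first.
  by move=> c pc; apply: dE; exists (p, phi).
rewrite -frename_param_comp => sphi.
have : type_formulas (r (sec p)) (frename (param_map d) phi) by [].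
rewrite secK (frename_param_eq (g := aut_inv k)) // => c pc.
by rewrite -{2}(kE c) ?aut_funK //; exists (p, phi).
Qed.

End restriction_retraction.

(** * Compatible equivalence relations on the two type spaces *)

Theorem theorem6p21 (L : language) (T : theory L) (C C' : structure L)
    (j : C -> C') (hj : elementary_embedding j)
    (lambda : Type) (X : set (lambda -> C)) (pX : set (formula L lambda))
    (F' : closed_invariant_equivalence (type_flow C' pX))
    (F : closed_invariant_equivalence (type_flow C pX)) :
  complete_theory T -> models C T -> models C' T ->
  aleph0_saturated C -> strongly_aleph0_homogeneous C ->
  aleph0_saturated C' -> strongly_aleph0_homogeneous C' ->
  type_defined_by X pX ->
  compatible hj F' F ->
  topologically_isomorphic_ellis_groups (quotient_flow F') (quotient_flow F).
Proof.
move=> _ _ _ satC homC _ homC' _ FF.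
have lift p q : eqv_rel F (p, q) -> exists p' q',
    [/\ eqv_rel F' (p', q'), type_restriction hj p' = p &
        type_restriction hj q' = q].
  by rewrite -FF => -[[p' q'] F'pq [pE qE]]; exists p', q'.
(* Surjectivity of the restriction comes from compatibility and reflexivity of [F]. *)
have /choice[sec secK] : forall p : type_space C pX,
    exists p', type_restriction hj p' = p.
  by move=> p; have [p' [_ [_ pE _]]] := lift p p (eqv_refl F p); exists p'.
have [h [hK Ehr Erh]] := restriction_section secK satC homC homC'.
apply: (@quotient_retraction_ellis_groups (type_flow C' pX) (type_flow C pX)
  (type_restriction hj) h).
- exact: type_restriction_continuous.
- exact: hK.
- by move=> p q pq; rewrite -FF; exists (p, q).
(* A pair in [F] is lifted to a pair in [F'], which the Ellis element given by [h] after restriction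
   preserves. *)
- move=> p q /lift [p' [q' [pq <- <-]]].
  exact: (ellis_eqv Ehr pq).
- exact: Ehr.
- exact: Erh.
- by move=> g; exact: restriction_translation_lift.
Qed.
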